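(* Let $f:\mathbb R^n\to\mathbb R$ be either linear, $f(x)=c^{\mathsf T}x$, or quadratic, $f(x)=\tfrac12x^{\mathsf T}Qx+q^{\mathsf T}x$ with $Q=Q^{\mathsf T}$ possibly indefinite, and let $\bar x\in\Omega$. The following statements are equivalent: (i) $\bar x$ is B-stationary for $\min_{x\in\Omega}f(x)$. (ii) For every $J\in\mathcal P(\bar x)$ and every $\Delta>0$, $p_J(\bar x,\Delta)=0$. (iii) There exists $\Delta_0>0$ such that $p_J(\bar x,\Delta_0)=0$ for all $J\in\mathcal P(\bar x)$. Moreover, if $\bar x$ is not B-stationary, then there exists $J_{\rm dec}\in\mathcal P(\bar x)$ such that $p_{J_{\rm dec}}(\bar x,\Delta)>0$ for all $\Delta>0$.
   Context: Let $n_0\ge0$, $m\ge1$ be integers, $n=n_0+2m$, and write $x=(x_0,x_1,x_2)\in\mathbb R^{n_0}\times\mathbb R^m\times\mathbb R^m$ for $x\in\mathbb R^n$. Fix matrices $A,B$ and vectors $a,b$ of compatible dimensions; vector inequalities are componentwise, $[m]=\{1,\dots,m\}$. The feasible set is $\Omega=\{x\in\mathbb R^n: Ax-a=0,\ Bx-b\ge0,\ x_1\ge0,\ x_2\ge0,\ x_{1,i}x_{2,i}=0\ \forall i\in[m]\}$. Labels and branches: $\mathcal P$ is the set of the $2^m$ ordered pairs $J=(D_1,D_2)$ with $D_1\cup D_2=[m]$, $D_1\cap D_2=\varnothing$; $\Omega_J=\{x: Ax-a=0,\ Bx-b\ge0,\ x_{1,i}=0,\,x_{2,i}\ge0\ (i\in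 D_1),\ x_{1,i}\ge0,\,x_{2,i}=0\ (i\in D_2)\}$. For $x\in\Omega$, $\mathcal P(x)=\{J\in\mathcal P: x\in\Omega_J\}$. For $x\in\Omega$, $J\in\mathcal P(x)$ and $\Delta>0$, the branch-LP predicted descent is $p_J(x,\Delta)=\max\{-\nabla f(x)^{\mathsf T}d: x+d\in\Omega_J,\ \|d\|_\infty\le\Delta\}$. The Bouligand tangent cone of $S\subseteq\mathbb R^n$ at $\bar x\in S$ is $T_S(\bar x)=\{d:\exists\,t_\ell\downarrow0,\ d^\ell\to d,\ \bar x+t_\ell d^\ell\in S\}$. A point $\bar x\in\Omega$ is B-stationary for $\min_\Omega f$ if $\nabla f(\bar x)^{\mathsf T}d\ge0$ for all $d\in T_\Omega(\bar x)$. *)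

(* Defs.v *)
From HB Require Import structures.
From mathcomp Require Import all_boot all_order all_algebra.
From mathcomp Require Import all_classical all_reals all_analysis.

Set Implicit Arguments.
Unset Strict Implicit.
Unset Printing Implicit Defensive.

Import Order.TTheory GRing.Theory Num.Theory.
Import numFieldNormedType.Exports.

Local Open Scope classical_set_scope.
Local Open Scope ring_scope.

Definition dotc (R : realType) (n : nat) (u v : 'cV[R]_n) : R :=
  (u^T *m v) 0 0.

Definition is_linear_obj (R : realType) (n : nat) (f : 'cV[R]_n -> R) : Prop :=
  exists c : 'cV[R]_n, forall x, f x = dotc c x.

Definition is_quadratic_obj (R : realType) (n : nat) (f : 'cV[R]_n -> R)
    : Prop :=
  exists (Q : 'M[R]_n) (q : 'cV[R]_n),
    Q = Q^T /\ forall x, f x = 2^-1 * dotc x (Q *m x) + dotc q x.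

Definition gradient (R : realType) (n : nat) (f : 'cV[R]_n -> R)
    (x : 'cV[R]_n) : 'cV[R]_n :=
  \col_i 'D_(delta_mx i 0) f x.

Definition tangent_cone (R : realType) (n : nat) (S : set 'cV[R]_n)
    (x : 'cV[R]_n) : set 'cV[R]_n :=
  [set d | exists (t : nat -> R) (d_ : nat -> 'cV[R]_n),
    [/\ forall l, 0 < t l,
        t @ \oo --> (0 : R),
        d_ @ \oo --> d
      & forall l, S (x + t l *: d_ l)]].

Definition B_stationary (R : realType) (n : nat) (S : set 'cV[R]_n)
    (f : 'cV[R]_n -> R) (x : 'cV[R]_n) : Prop :=
  S x /\ forall d, tangent_cone S x d -> 0 <= dotc (gradient f x) d.

(* A vector of R^(n0 + (m + m)) is the column of blocks (x_0, x_1, x_2). *)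
Definition blk1 (R : realType) (n0 m : nat) (x : 'cV[R]_(n0 + (m + m)))
    : 'cV[R]_m := usubmx (dsubmx x).

Definition blk2 (R : realType) (n0 m : nat) (x : 'cV[R]_(n0 + (m + m)))
    : 'cV[R]_m := dsubmx (dsubmx x).

Definition lin_feasible (R : realType) (n r s : nat)
    (A : 'M[R]_(r, n)) (a : 'cV[R]_r) (B : 'M[R]_(s, n)) (b : 'cV[R]_s)
    : set 'cV[R]_n :=
  [set x | A *m x - a = 0 /\ forall i, 0 <= (B *m x - b) i 0].

Definition Omega (R : realType) (n0 m r s : nat)
    (A : 'M[R]_(r, n0 + (m + m))) (a : 'cV[R]_r)
    (B : 'M[R]_(s, n0 + (m + m))) (b : 'cV[R]_s)
    : set 'cV[R]_(n0 + (m + m)) :=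
  [set x | [/\ lin_feasible A a B b x,
               forall i, 0 <= blk1 x i 0,
               forall i, 0 <= blk2 x i 0
             & forall i, blk1 x i 0 * blk2 x i 0 = 0]].

Definition labels (m : nat) : set ({set 'I_m} * {set 'I_m}) :=
  [set J | J.1 :|: J.2 = finset.setT /\ J.1 :&: J.2 = finset.set0].

Definition Omega_br (R : realType) (n0 m r s : nat)
    (A : 'M[R]_(r, n0 + (m + m))) (a : 'cV[R]_r)
    (B : 'M[R]_(s, n0 + (m + m))) (b : 'cV[R]_s)
    (J : {set 'I_m} * {set 'I_m}) : set 'cV[R]_(n0 + (m + m)) :=
  [set x | [/\ lin_feasible A a B b x,
               forall i, i \in J.1 -> blk1 x i 0 = 0 /\ 0 <= blk2 x i 0
             & forall i, i \in J.2 -> 0 <= blk1 x i 0 /\ blk2 x i 0 = 0]].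

Definition active_labels (R : realType) (n0 m r s : nat)
    (A : 'M[R]_(r, n0 + (m + m))) (a : 'cV[R]_r)
    (B : 'M[R]_(s, n0 + (m + m))) (b : 'cV[R]_s)
    (x : 'cV[R]_(n0 + (m + m))) : set ({set 'I_m} * {set 'I_m}) :=
  [set J | labels J /\ Omega_br A a B b J x].

(* The norm `|d| on matrices is the entrywise maximum norm. *)
Definition branch_descents (R : realType) (n0 m r s : nat)
    (A : 'M[R]_(r, n0 + (m + m))) (a : 'cV[R]_r)
    (B : 'M[R]_(s, n0 + (m + m))) (b : 'cV[R]_s)
    (f : 'cV[R]_(n0 + (m + m)) -> R) (J : {set 'I_m} * {set 'I_m})
    (x : 'cV[R]_(n0 + (m + m))) (Delta : R) : set R :=
  [set - dotc (gradient f x) d | d in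
    [set d | Omega_br A a B b J (x + d) /\ `|d| <= Delta]].

(* sup stands for the maximum; it is attained whenever x lies on the branch J
   and Delta >= 0 (pred_descent_max), so its default value is never used. *)
Definition pred_descent (R : realType) (n0 m r s : nat)
    (A : 'M[R]_(r, n0 + (m + m))) (a : 'cV[R]_r)
    (B : 'M[R]_(s, n0 + (m + m))) (b : 'cV[R]_s)
    (f : 'cV[R]_(n0 + (m + m)) -> R) (J : {set 'I_m} * {set 'I_m})
    (x : 'cV[R]_(n0 + (m + m))) (Delta : R) : R :=
  sup (branch_descents A a B b f J x Delta).

Lemma entry_continuous (R : realType) (k n : nat) (M : 'M[R]_(k, n))
    (x : 'cV[R]_n) (i : 'I_k) :
  continuous (fun d : 'rV[R]_n => (M *m (x + d^T)) i 0).
Proof.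
have -> : (fun d : 'rV[R]_n => (M *m (x + d^T)) i 0) =
    (fun d => \sum_(j < n) M i j * (x j 0 + d 0 j)).
  by apply/funext => d; rewrite mxE; apply: eq_bigr => j _; rewrite !mxE.
have addc : continuous (fun z : R * R => z.1 + z.2).
  by move=> z; exact: (@add_continuous R^o z).
apply: (@continuous_big R 'I_n +%R 0 xpredT addc).
move=> j _ d.
apply: (@continuousM R _ (fun=> M i j) (fun d : 'rV[R]_n => x j 0 + d 0 j)).
  exact: cst_continuous.
apply: (@continuousD R R _ (fun=> x j 0) (fun d : 'rV[R]_n => d 0 j)).
  exact: cst_continuous.
exact: (@coord_continuous R 1 n 0 j).
Qed.

Lemma closed_entry (R : realType) (n : nat) (x : 'cV[R]_n) (i : 'I_n)
    (C : set R) :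
  closed C -> closed [set d : 'rV[R]_n | C ((x + d^T) i 0)].
Proof.
move=> clC; have := @entry_continuous R n n 1%:M x i.
under eq_fun do rewrite mul1mx.
by move=> h; apply: (preimage_closed _ clC) => d _; exact: h.
Qed.

Lemma closed_branch_tr (R : realType) (n0 m r s : nat)
    (A : 'M[R]_(r, n0 + (m + m))) (a : 'cV[R]_r)
    (B : 'M[R]_(s, n0 + (m + m))) (b : 'cV[R]_s)
    (J : {set 'I_m} * {set 'I_m}) (x : 'cV[R]_(n0 + (m + m))) :
  closed [set d : 'rV[R]_(n0 + (m + m)) | Omega_br A a B b J (x + d^T)].
Proof.
have -> : [set d : 'rV[R]_(n0 + (m + m)) | Omega_br A a B b J (x + d^T)] =
  (\bigcap_i [set d | (A *m (x + d^T)) i 0 = a i 0]) `&`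
  (\bigcap_i [set d | b i 0 <= (B *m (x + d^T)) i 0]) `&`
  ((\bigcap_(i in [set i | i \in J.1])
     ([set d | (x + d^T) (rshift n0 (lshift m i)) 0 = 0] `&`
      [set d | 0 <= (x + d^T) (rshift n0 (rshift m i)) 0])) `&`
   (\bigcap_(i in [set i | i \in J.2])
     ([set d | 0 <= (x + d^T) (rshift n0 (lshift m i)) 0] `&`
      [set d | (x + d^T) (rshift n0 (rshift m i)) 0 = 0]))).
  rewrite predeqE => d; rewrite /Omega_br /lin_feasible /blk1 /blk2 /=.
  split.
    case=> -[hA hB] h1 h2; split; [split => i _ /=|split => i Ji].
    - by move/matrixP/(_ i 0)/eqP: hA; rewrite !mxE subr_eq0 => /eqP.
    - by have := hB i; rewrite !mxE subr_ge0.
    - by have := h1 i Ji; rewrite /= !mxE.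
    - by have := h2 i Ji; rewrite /= !mxE.
  case=> -[hA hB] [h1 h2]; split; [split|move=> i Ji|move=> i Ji].
  - apply/colP => i; move: (hA i I) => /= e.
    by rewrite mxE e !mxE subrr.
  - by move=> i; have := hB i I; rewrite /= !mxE subr_ge0.
  - by have := h1 i Ji; rewrite /= !mxE.
  - by have := h2 i Ji; rewrite /= !mxE.
apply: closedI; apply: closedI.
- apply: closed_bigI => i _; apply: (preimage_closed _ (@closed_eq _ (a i 0))).
  by move=> d _; exact: entry_continuous.
- apply: closed_bigI => i _; apply: (preimage_closed _ (@closed_ge _ (b i 0))).
  by move=> d _; exact: entry_continuous.
- apply: closed_bigI => i _; apply: closedI.
    exact: (closed_entry (@closed_eq _ 0)).
  exact: (closed_entry (@closed_ge _ 0)).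
- apply: closed_bigI => i _; apply: closedI.
    exact: (closed_entry (@closed_ge _ 0)).
  exact: (closed_entry (@closed_eq _ 0)).
Qed.

Lemma pred_descent_max (R : realType) (n0 m r s : nat)
    (A : 'M[R]_(r, n0 + (m + m))) (a : 'cV[R]_r)
    (B : 'M[R]_(s, n0 + (m + m))) (b : 'cV[R]_s)
    (f : 'cV[R]_(n0 + (m + m)) -> R) (J : {set 'I_m} * {set 'I_m})
    (x : 'cV[R]_(n0 + (m + m))) (Delta : R) :
  Omega_br A a B b J x -> 0 <= Delta ->
  branch_descents A a B b f J x Delta (pred_descent A a B b f J x Delta) /\
  ubound (branch_descents A a B b f J x Delta)
         (pred_descent A a B b f J x Delta).
Proof.
move=> xJ D0; set g := gradient f x.
have norm_tr (d : 'rV[R]_(n0 + (m + m))) : `|d^T| = `|d|.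
  have key k l (M : 'M[R]_(k, l)) (e : R) : 0 <= e ->
      (`|M| <= e) = [forall i, forall j, `|M i j| <= e].
    move=> e0; rewrite [X in X <= _]/Num.norm /= mx_normrE.
    apply/bigmax_leP/forallP => [[_ h] i|h]; first by apply/forallP => j; exact: (h (i, j)).
    by split=> // -[i j] _; have /forallP := h i; apply.
  apply/eqP; rewrite eq_le !key //; apply/andP; split; apply/forallP => i;
    apply/forallP => j.
    rewrite mxE; have := lexx `|d|; rewrite {1}key // => /forallP/(_ j)/forallP.
    exact.
  have := lexx `|d^T|; rewrite {1}key // => /forallP/(_ j)/forallP/(_ i).
  by rewrite mxE.
pose K := [set d : 'rV[R]_(n0 + (m + m)) | Omega_br A a B b J (x + d^T)] `&`
          [set d | `|d| <= Delta].
have K0 : K !=set0.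
  by exists 0; split => /=; rewrite ?trmx0 ?addr0 ?normr0.
have cK : compact K.
  apply: bounded_closed_compact.
    exists Delta; split; first exact: num_real.
    by move=> M /ltW DM d [_ /= dD]; exact: le_trans dD DM.
  apply: closedI; first exact: closed_branch_tr.
  apply: (preimage_closed _ (@closed_le _ Delta)) => d _; exact: norm_continuous.
have cF : {within K, continuous (fun d : 'rV[R]_(n0 + (m + m)) => - dotc g d^T)}.
  apply: continuous_subspaceT => d.
  apply: (@continuousN R R _ (fun d : 'rV[R]_(n0 + (m + m)) => dotc g d^T)).
  have : continuous (fun d : 'rV[R]_(n0 + (m + m)) => (g^T *m d^T) 0 0).
    have := @entry_continuous R 1 _ g^T 0 0.
    by under eq_fun do rewrite add0r.
  exact.
have [d /set_mem [dJ dD] dmax] := EVT_max_rV K0 cK cF.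
have ubd : ubound (branch_descents A a B b f J x Delta) (- dotc g d^T).
  move=> _ [e [eJ eD] <-]; rewrite -(trmxK e); apply: dmax.
  by apply/mem_set; split; rewrite /= ?trmxK // -norm_tr trmxK.
have ind : branch_descents A a B b f J x Delta (- dotc g d^T).
  by exists d^T => //; split => //; rewrite norm_tr.
suff -> : pred_descent A a B b f J x Delta = - dotc g d^T by split.
apply/eqP; rewrite eq_le; apply/andP; split.
  by apply: ge_sup => //; exists (- dotc g d^T).
by apply: ub_le_sup => //; exists (- dotc g d^T).
Qed.

(* Main.v *)
(* Near xbar, a feasible point cannot lose a nonzero coordinate of xbar, so it
   lies on one of the finitely many branches through xbar. Hence a tangent
   direction of negative slope yields a feasible step of negative slope inside
   one such branch. Branches are convex, so that step may be shrunk into any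
   trust region (positive predicted descent for every radius), and conversely
   every feasible step along a branch is a tangent direction. Only the gradient
   at xbar enters, never the values of f. *)
Require Import Defs.
From mathcomp Require Import all_boot all_order all_algebra.
From mathcomp Require Import all_classical all_reals all_analysis.
From mathcomp Require Import ring.
Import Order.TTheory GRing.Theory Num.Theory.
Import numFieldNormedType.Exports.
Local Open Scope classical_set_scope.
Local Open Scope ring_scope.

Section ConvexBranches.
Set Implicit Arguments.
Unset Strict Implicit.
Context {R : realType} {n0 m r s : nat}.
Context (A : 'M[R]_(r, n0 + (m + m))) (a : 'cV[R]_r).
Context (B : 'M[R]_(s, n0 + (m + m))) (b : 'cV[R]_s).
Implicit Types (J : {set 'I_m} * {set 'I_m}) (x y d : 'cV[R]_(n0 + (m + m))).

Lemma labelsC (D : {set 'I_m}) : labels (D, ~: D).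
Proof. by split; rewrite /= ?finset.setUCr ?finset.setICr. Qed.

Lemma Omega_br_sub J : labels J -> Omega_br A a B b J `<=` Omega A a B b.
Proof.
case=> JT _ x [xlin x1 x2].
have cover i : blk1 x i 0 = 0 /\ 0 <= blk2 x i 0 \/
               0 <= blk1 x i 0 /\ blk2 x i 0 = 0.
  have /finset.setUP[/x1|/x2] : i \in J.1 :|: J.2 by rewrite JT finset.in_setT.
  - by left.
  - by right.
split => // i; case: (cover i) => -[e1 e2]; rewrite ?e1 ?e2 //.
- by rewrite mul0r.
- by rewrite mulr0.
Qed.

(** Once the label is fixed, every condition is an equality or inequality on an affine function,
    hence passes to the convex combination [(1 - t) x + t (x + d)]. *)
Lemma Omega_br_segment J x d (t : R) : Omega_br A a B b J x ->
  Omega_br A a B b J (x + d) -> 0 <= t <= 1 ->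
  Omega_br A a B b J (x + t *: d).
Proof.
move=> [[xA xB] x1 x2] [[yA yB] y1 y2] /andP[t0 t1].
have conv (u v : R) : u + t * v = (1 - t) * u + t * (u + v) by ring.
have conv_ge0 (u v : R) : 0 <= u -> 0 <= u + v -> 0 <= u + t * v.
  by move=> u0 v0; rewrite conv addr_ge0 // mulr_ge0 // subr_ge0.
have conv_eq0 (u v : R) : u = 0 -> u + v = 0 -> u + t * v = 0.
  by move=> u0 v0; rewrite conv u0 -{2}u0 v0 !mulr0 addr0.
have affE k (M : 'M[R]_(k, n0 + (m + m))) (c : 'cV[R]_k) (e : R) i :
    (M *m (x + e *: d) - c) i 0 = (M *m x - c) i 0 + e * (M *m d) i 0.
  by rewrite mulmxDr -scalemxAr !mxE addrAC.
have aff1E k (M : 'M[R]_(k, n0 + (m + m))) (c : 'cV[R]_k) i :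
    (M *m (x + d) - c) i 0 = (M *m x - c) i 0 + (M *m d) i 0.
  by rewrite -{1}[d]scale1r affE mul1r.
split; first split.
- apply/colP => i; rewrite affE [RHS]mxE.
  by apply: conv_eq0; rewrite -?aff1E ?xA ?yA mxE.
- by move=> i; rewrite affE; apply: conv_ge0; rewrite -?aff1E.
- move=> i iJ; have [u1 v1] := x1 i iJ; have [] := y1 i iJ.
  rewrite /blk1 /blk2 !mxE in u1 v1 * => u2 v2.
  by split; [exact: conv_eq0|exact: conv_ge0].
- move=> i iJ; have [u1 v1] := x2 i iJ; have [] := y2 i iJ.
  rewrite /blk1 /blk2 !mxE in u1 v1 * => u2 v2.
  by split; [exact: conv_ge0|exact: conv_eq0].
Qed.

(** Read contrapositively, the support hypothesis sends zeros of [y] to zeros of [x], so a branch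
    selected by the zeros of [y] also passes through [x]. *)
Lemma active_label_near x y : Omega A a B b x -> Omega A a B b y ->
  (forall k, x k 0 != 0 -> y k 0 != 0) ->
  exists2 J, active_labels A a B b x J & Omega_br A a B b J y.
Proof.
move=> [xlin x1 x2 x12] [ylin y1 y2 y12] supp.
have y1x i : blk1 y i 0 = 0 -> blk1 x i 0 = 0.
  rewrite /blk1 !mxE => yi; apply/eqP; apply: contraT => /supp.
  by rewrite yi eqxx.
have y2x i : blk2 y i 0 = 0 -> blk2 x i 0 = 0.
  rewrite /blk2 !mxE => yi; apply/eqP; apply: contraT => /supp.
  by rewrite yi eqxx.
(* Indices where both blocks of [y] vanish go to the first part; off [D], complementarity of [y]
   annihilates its second block. *)
pose D : {set 'I_m} := [set i | blk1 y i 0 == 0]%SET.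
have D1 i : i \in D -> blk1 y i 0 = 0 by rewrite inE => /eqP.
have D2 i : i \in ~: D -> blk2 y i 0 = 0.
  rewrite !inE => yi; have /eqP := y12 i.
  by rewrite mulf_eq0 (negbTE yi) => /eqP.
exists (D, ~: D).
  split; first exact: labelsC.
  split => //= i iD; split => //; [exact/y1x/D1|exact/y2x/D2].
by split => //= i iD; split => //; [exact: D1|exact: D2].
Qed.

End ConvexBranches.

Section TangentCone.
Set Implicit Arguments.
Unset Strict Implicit.
Context {R : realType} {n : nat}.
Implicit Types (S : set 'cV[R]_n) (x d g : 'cV[R]_n).

Lemma dotcZr g d (t : R) : dotc g (t *: d) = t * dotc g d.
Proof. by rewrite /dotc -scalemxAr mxE. Qed.

Lemma dotc_cvg g (d_ : nat -> 'cV[R]_n) d :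
  d_ @ \oo --> d -> dotc g (d_ l) @[l --> \oo] --> dotc g d.
Proof.
move=> dcvg.
have dotE e : dotc g e = \sum_j g j 0 * e j 0.
  by rewrite /dotc mxE; apply: eq_bigr => j _; rewrite mxE.
rewrite dotE; under eq_fun do rewrite dotE.
apply: cvg_big => [|j _]; first exact: add_continuous.
apply: cvgM; first exact: cvg_cst.
exact: (cvg_comp _ _ dcvg (@coord_continuous R n 1 j 0 d)).
Qed.

(** Step lengths [1 / (l + 1)] along the constant direction [d] witness tangency. *)
Lemma tangent_cone_segment S x d :
  (forall t : R, 0 <= t <= 1 -> S (x + t *: d)) -> tangent_cone S x d.
Proof.
move=> Sxd; exists harmonic, (fun=> d); split.
- by move=> l; rewrite invr_gt0 ltr0n.
- exact: cvg_harmonic.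
- exact: cvg_cst.
- by move=> l; apply: Sxd; rewrite invr_ge0 ler0n invf_le1 ?ltr0n ?ler1n.
Qed.

(** The step is [t l *: d_ l] for one large [l]: the slope along [d_ l] tends to that along [d], and
    the points tend to [x], so coordinates in the support of [x] are eventually nonzero. *)
Lemma tangent_cone_support S x d g : tangent_cone S x d -> dotc g d < 0 ->
  exists2 e, dotc g e < 0 & S (x + e) /\
    forall k, x k 0 != 0 -> (x + e) k 0 != 0.
Proof.
move=> [t [d_ [t0 tcvg dcvg Sxd]]] gd.
have supp k : \forall l \near \oo, x k 0 != 0 -> (x + t l *: d_ l) k 0 != 0.
  have [_|xk] := eqVneq (x k 0) 0; first exact: nearW.
  have entry : (x + t l *: d_ l) k 0 @[l --> \oo] --> x k 0.
    under eq_fun do rewrite !mxE.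
    have dk := cvg_comp _ _ dcvg (@coord_continuous R n 1 k 0 d).
    have := cvgD (@cvg_cst _ (x k 0) _ _ _) (cvgM tcvg dk).
    by rewrite mul0r addr0; exact.
  by apply: filterS (cvgr_neq0 _ entry xk) => l.
have neg : \forall l \near \oo, dotc g (d_ l) < 0.
  exact: (cvgr_lt _ (dotc_cvg dcvg)).
(* There are finitely many coordinates, so their eventual conditions hold simultaneously. *)
have [l [gl suppl]] :=
    filter_ex (filterI neg (filter_forall _ supp)).
by exists (t l *: d_ l) => //; rewrite dotcZr pmulr_rlt0.
Qed.

End TangentCone.

Section BranchDescent.
Set Implicit Arguments.
Unset Strict Implicit.
Context {R : realType} {n0 m r s : nat}.
Context (A : 'M[R]_(r, n0 + (m + m))) (a : 'cV[R]_r).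
Context (B : 'M[R]_(s, n0 + (m + m))) (b : 'cV[R]_s).
Context (f : 'cV[R]_(n0 + (m + m)) -> R).
Implicit Types (J : {set 'I_m} * {set 'I_m}) (x d : 'cV[R]_(n0 + (m + m))).

Lemma pred_descent_ge0 J x (Delta : R) : Omega_br A a B b J x ->
  0 <= Delta -> 0 <= pred_descent A a B b f J x Delta.
Proof.
move=> xJ D0; have [_ ub] := pred_descent_max f xJ D0.
apply: ub; exists 0; first by split; rewrite /= ?addr0 ?normr0.
by rewrite /dotc mulmx0 mxE oppr0.
Qed.

(** Shrinking a step into the trust region keeps the sign of its slope, so the radius drops out of
    the criterion; this makes one radius as good as all. *)
Lemma pred_descent_eq0P J x (Delta : R) : Omega_br A a B b J x -> 0 < Delta ->
  pred_descent A a B b f J x Delta = 0 <->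
  forall d, Omega_br A a B b J (x + d) -> 0 <= dotc (gradient f x) d.
Proof.
move=> xJ D0; have [[e [eJ _] eE] ub] := pred_descent_max f xJ (ltW D0).
split => [p0 d dJ|gd]; last first.
  (* The maximum is attained at [e], itself a branch step, so its slope is nonnegative. *)
  apply/eqP; rewrite eq_le (pred_descent_ge0 xJ (ltW D0)) andbT.
  by rewrite -eE oppr_le0; exact: gd.
have N0 : 0 < Delta + `|d| by rewrite ltr_pwDl.
(* This factor is at most 1 and scales [d] to norm at most [Delta], with no separate case for
   [d = 0]. *)
pose t := Delta / (Delta + `|d|).
have t0 : 0 < t by rewrite divr_gt0.
have tdJ : Omega_br A a B b J (x + t *: d).
  apply: Omega_br_segment => //.
  by rewrite ltW //= ler_pdivrMr // mul1r lerDl.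
have tdD : `|t *: d| <= Delta.
  rewrite normrZ gtr0_norm // /t mulrAC ler_pdivrMr // ler_pM2l //.
  by rewrite lerDr ltW.
have := ub _ (ex_intro2 _ _ (t *: d) (conj tdJ tdD) erefl).
by rewrite p0 oppr_le0 dotcZr pmulr_rge0.
Qed.

Lemma B_stationaryP x : Omega A a B b x ->
  B_stationary (Omega A a B b) f x <->
  forall J, active_labels A a B b x J ->
    forall d, Omega_br A a B b J (x + d) -> 0 <= dotc (gradient f x) d.
Proof.
move=> xO; split => [[_ stat] J [Jlab xJ] d dJ|stat].
  apply: stat; apply: tangent_cone_segment => t t01.
  by apply: (Omega_br_sub Jlab); exact: Omega_br_segment.
split => // d dT; rewrite leNgt; apply/negP => gd.
(* The tangent direction itself need not be a feasible step, so it is traded for one that keeps the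
   support of [x]. *)
have [e ge [eO supp]] := tangent_cone_support dT gd.
have [J xJ eJ] := active_label_near xO eO supp.
by have := stat J xJ e eJ; rewrite leNgt ge.
Qed.

End BranchDescent.

Theorem proposition2 (R : realType) (n0 m r s : nat) (m_ge1 : (1 <= m)%N)
    (A : 'M[R]_(r, n0 + (m + m))) (a : 'cV[R]_r)
    (B : 'M[R]_(s, n0 + (m + m))) (b : 'cV[R]_s)
    (f : 'cV[R]_(n0 + (m + m)) -> R)
    (f_lin_or_quad : is_linear_obj f \/ is_quadratic_obj f)
    (xbar : 'cV[R]_(n0 + (m + m))) (xbar_feas : Omega A a B b xbar) :
  [/\ (* (i) <-> (ii) *)
      B_stationary (Omega A a B b) f xbar <->
      (forall J, active_labels A a B b xbar J ->
       forall Delta : R, 0 < Delta ->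
         pred_descent A a B b f J xbar Delta = 0),
      (* (i) <-> (iii) *)
      B_stationary (Omega A a B b) f xbar <->
      (exists2 Delta0 : R, 0 < Delta0 &
       forall J, active_labels A a B b xbar J ->
         pred_descent A a B b f J xbar Delta0 = 0)
    & ~ B_stationary (Omega A a B b) f xbar ->
      exists2 Jdec, active_labels A a B b xbar Jdec &
       forall Delta : R, 0 < Delta ->
         0 < pred_descent A a B b f Jdec xbar Delta].
Proof.
have statP := B_stationaryP f xbar_feas.
have desc0P J (Delta : R) : active_labels A a B b xbar J -> 0 < Delta ->
    pred_descent A a B b f J xbar Delta = 0 <->
    forall d, Omega_br A a B b J (xbar + d) -> 0 <= dotc (gradient f xbar) d.
  by move=> [_ xJ]; exact: pred_descent_eq0P.
split.
- split => [/statP stat J xJ Delta D0|p0].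
    by apply/(desc0P _ _ xJ D0); exact: stat.
  by apply/statP => J xJ; apply/(desc0P _ _ xJ ltr01)/p0.
- split => [/statP stat|[Delta D0 p0]].
    by exists 1 => // J xJ; apply/(desc0P _ _ xJ ltr01); exact: stat.
  by apply/statP => J xJ; apply/(desc0P _ _ xJ D0)/p0.
- move=> nstat; apply: contrapT => noJ; apply: nstat; apply/statP => J xJ.
  (* A branch violating the radius-free criterion has nonzero, hence positive, predicted descent at
     every radius. *)
  apply: contrapT => gJ; apply: noJ; exists J => // Delta D0.
  rewrite lt_neqAle pred_descent_ge0 ?andbT; [|by case: xJ|exact: ltW].
  by rewrite eq_sym; apply/eqP => /(desc0P _ _ xJ D0).
Qed.
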